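(* Let $m\ge 1$ be an integer and $c\in\mathbb{C}\setminus\{0\}$. For each $n\in\{1,\dots,m\}$ define $\xi^{(n)}=(\xi^{(n)}_1,\dots,\xi^{(n)}_m)\in\mathbb{C}^m$ by $$\xi^{(n)}_i=\begin{cases}\dfrac{(n)_i}{c}, & 1\le i\le n,\\[4pt] 0, & n<i\le m,\end{cases}$$ where $(n)_i=n(n-1)\cdots(n-i+1)$ is the falling factorial. Then each $\xi^{(n)}$ satisfies the indicial equations $$-i\,\xi_i=f_i^A(\xi),\qquad i=1,\dots,m,$$ of the autonomous Riccati hierarchy. Moreover, $\xi^{(1)},\dots,\xi^{(m)}$ are the only nonzero solutions $\xi\in\mathbb{C}^m$ of these indicial equations.
   Context: The autonomous $m$-th Riccati hierarchy with constant $c\in\mathbb{C}\setminus\{0\}$ is the system $dx_i/dz=f_i^A(x)$, $i=1,\dots,m$, on $\mathbb{C}^m$, where $$f_i^A(x)=x_{i+1}-c\,x_1x_i\quad(1\le i\le m-1),\qquad f_m^A(x)=-c\,x_1x_m .$$ (For $m=1$ only the last formula is present.) The variables have weights $p_i=i$. The indicial equations are $-p_i\xi_i=f_i^A(\xi)$, $i=1,\dots,m$; a nonzero solution $\xi$ is called an indicial locus. *)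

(* Defs.v *)
From HB Require Import structures.
From mathcomp Require Import all_boot all_order all_algebra.
From mathcomp Require Import reals.
From mathcomp Require Import complex.

Set Implicit Arguments.
Unset Strict Implicit.
Unset Printing Implicit Defensive.

Import Order.TTheory GRing.Theory Num.Theory.
Local Open Scope ring_scope.

(* Coordinates are 0-based: the mathematical coordinate x_i, 1 <= i <= m, is
   [x 0 j] with [j : 'I_m] of value i - 1. *)

(* Right-hand side f^A of the autonomous m-th Riccati hierarchy
     f_i(x) = x_{i+1} - c x_1 x_i  (i < m),    f_m(x) = - c x_1 x_m.
   [insub i.+1 : option 'I_m] is [None] exactly when [i] is the last index. *)
Definition riccatiA (K : comNzRingType) (m : nat) (hm : (0 < m)%N) (c : K)
    (x : 'rV[K]_m) : 'rV[K]_m :=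
  let x1 := x 0 (Ordinal hm) in
  \row_(i < m)
    if insub i.+1 is Some j then x 0 j - c * x1 * x 0 i
    else - (c * x1 * x 0 i).

Definition riccati_weight (m : nat) (i : 'I_m) : nat := i.+1.

Definition indicial_equations (K : comNzRingType) (m : nat) (p : 'I_m -> nat)
    (f : 'rV[K]_m -> 'rV[K]_m) (xi : 'rV[K]_m) : Prop :=
  forall i : 'I_m, - (p i)%:R * xi 0 i = f xi 0 i.

Definition indicial_locus (K : comNzRingType) (m : nat) (p : 'I_m -> nat)
    (f : 'rV[K]_m -> 'rV[K]_m) (xi : 'rV[K]_m) : Prop :=
  xi <> 0 /\ indicial_equations p f xi.

(* [n ^_ k] is the falling factorial (n)_k. *)
Definition riccati_locus (K : fieldType) (m : nat) (c : K) (n : nat) :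
    'rV[K]_m :=
  \row_(i < m) if (i.+1 <= n)%N then (n ^_ i.+1)%:R / c else 0.

(* Main.v *)
Require Import Defs.
From HB Require Import structures.
From mathcomp Require Import all_boot all_order all_algebra.
From mathcomp Require Import reals.
From mathcomp Require Import complex.

(** Extend a vector [xi] by zero beyond its last coordinate and put
    [s = c * xi_1].  The last component of the Riccati field then has the same
    shape as the others, and the indicial equations become the single two-term
    recurrence [xi_(i+1) = (s - i) xi_i] for [1 <= i <= m], with the boundary
    condition [xi_(m+1) = 0] ([indicial_recurrence]).  Its solution is the
    falling factorial of the scalar [s]: [c xi_i = s (s - 1) ... (s - i + 1)]
    ([recurrence_solution]).  The boundary condition thus reads
    [s (s - 1) ... (s - m) = 0], which forces [s] to be one of [0, ..., m].
    If [s = 0] then [xi = 0]; if [s = n >= 1] then [xi] is the [n]-th locus.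
    Conversely, the falling factorials of a natural number [n <= m] satisfy the
    recurrence and vanish at index [m + 1]. *)

Set Implicit Arguments.
Unset Strict Implicit.
Unset Printing Implicit Defensive.

Import Order.TTheory GRing.Theory Num.Theory.
Local Open Scope ring_scope.

Definition zero_ext (K : nmodType) (m : nat) (x : 'rV[K]_m) (k : nat) : K :=
  if insub k is Some j then x 0 j else 0.

Lemma zero_ext_ord (K : nmodType) (m : nat) (x : 'rV[K]_m) (i : 'I_m) :
  zero_ext x i = x 0 i.
Proof. by rewrite /zero_ext valK. Qed.

Lemma zero_ext_ge (K : nmodType) (m : nat) (x : 'rV[K]_m) (k : nat) :
  (m <= k)%N -> zero_ext x k = 0.
Proof. by move=> le_mk; rewrite /zero_ext insubN // -leqNgt. Qed.

(** Extension by zero absorbs the special form of the last component of the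
    field; the truncation survives only as the value 0 of [zero_ext xi m]. *)
Lemma indicial_recurrence (K : comNzRingType) (m : nat) (hm : (0 < m)%N)
    (c : K) (xi : 'rV[K]_m) :
  indicial_equations (@riccati_weight m) (riccatiA hm c) xi <->
  (forall k : nat, (k < m)%N ->
     zero_ext xi k.+1 = (c * zero_ext xi 0 - k.+1%:R) * zero_ext xi k).
Proof.
have x1E : zero_ext xi 0 = xi 0 (Ordinal hm).
  by rewrite -(zero_ext_ord xi (Ordinal hm)).
have fE (i : 'I_m) :
    riccatiA hm c xi 0 i = zero_ext xi i.+1 - c * zero_ext xi 0 * zero_ext xi i.
  rewrite mxE zero_ext_ord x1E /zero_ext.
  by case: (insub i.+1) => [j|] //; rewrite sub0r.
split=> [eqs k lt_km | rec i].
  have := eqs (Ordinal lt_km); rewrite fE -zero_ext_ord /riccati_weight /=.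
  by move/eqP; rewrite eq_sym subr_eq => /eqP ->; rewrite mulrBl mulNr addrC.
rewrite fE rec // -(zero_ext_ord xi i) /riccati_weight.
by rewrite mulrBl mulNr addrAC subrr add0r.
Qed.

(** Iterating the recurrence yields the factors [s - 1, ..., s - k], where
    [s = c * a 0]; the normalisation by [c] turns the initial value into the
    missing factor [s - 0]. *)
Lemma recurrence_solution (K : comNzRingType) (m : nat) (c : K) (a : nat -> K) :
  (forall k : nat, (k < m)%N -> a k.+1 = (c * a 0%N - k.+1%:R) * a k) ->
  forall k : nat, (k <= m)%N ->
    c * a k = \prod_(j < k.+1) (c * a 0%N - j%:R).
Proof.
move=> rec; elim=> [_|k IHk lt_km]; first by rewrite big_ord1 subr0.
by rewrite big_ord_recr /= -IHk ?(ltnW lt_km) // rec // mulrCA mulrC.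
Qed.

(** The truncated subtractions in the natural falling factorial are harmless:
    once [k > n], both sides contain the factor [n - n = 0]. *)
Lemma natr_ffact (K : comNzRingType) (n k : nat) :
  (n ^_ k)%:R = \prod_(j < k) (n%:R - j%:R) :> K.
Proof.
elim: k => [|k IHk]; first by rewrite big_ord0.
rewrite big_ord_recr /= -IHk ffactnSr natrM.
have [le_kn|lt_nk] := leqP k n; first by rewrite natrB.
by rewrite ffact_small // !mul0r.
Qed.

Lemma zero_ext_riccati_locus (K : fieldType) (m : nat) (c : K) (n k : nat) :
  (n <= m)%N -> zero_ext (riccati_locus m c n) k = (n ^_ k.+1)%:R / c.
Proof.
move=> le_nm; have [lt_km|le_mk] := ltnP k m; last first.
  by rewrite zero_ext_ge // ffact_small ?mul0r // ltnS (leq_trans le_nm).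
rewrite (zero_ext_ord _ (Ordinal lt_km)) mxE /=.
by case: leqP => // lt_nk; rewrite ffact_small ?mul0r.
Qed.

Lemma zero_ext_inj (K : nmodType) (m : nat) (x y : 'rV[K]_m) :
  (forall k : nat, (k < m)%N -> zero_ext x k = zero_ext y k) -> x = y.
Proof. by move=> eq_xy; apply/rowP=> i; rewrite -!zero_ext_ord eq_xy. Qed.

Lemma riccati_locus_indicial (K : fieldType) (m : nat) (hm : (0 < m)%N) (c : K)
    (n : nat) :
  c != 0 -> (n <= m)%N ->
  indicial_equations (@riccati_weight m) (riccatiA hm c) (riccati_locus m c n).
Proof.
move=> c0 le_nm; apply/indicial_recurrence => k _.
rewrite !zero_ext_riccati_locus // ffactn1 [c * _]mulrC divfK //.
by rewrite !natr_ffact [in LHS]big_ord_recr /= mulrAC mulrC.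
Qed.

(** The boundary condition at index [m] makes [c * xi_1] a root of the monic
    polynomial [X (X - 1) ... (X - m)]; this root determines [xi].  The root 0
    gives the zero vector, which is the value of [riccati_locus] at [n = 0]. *)
Lemma indicial_is_riccati_locus (K : fieldType) (m : nat) (hm : (0 < m)%N)
    (c : K) (xi : 'rV[K]_m) :
  c != 0 -> indicial_equations (@riccati_weight m) (riccatiA hm c) xi ->
  exists2 n : nat, (n <= m)%N & xi = riccati_locus m c n.
Proof.
move=> c0 /indicial_recurrence /recurrence_solution sol.
have /eqP := sol m (leqnn m); rewrite zero_ext_ge // mulr0 eq_sym.
move=> /prodf_eq0 [[n lt_nm] _ /=]; rewrite subr_eq0 => /eqP sE.
exists n => //; apply: zero_ext_inj => k lt_km.
apply: (mulfI c0); rewrite sol ?(ltnW lt_km) // sE.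
by rewrite zero_ext_riccati_locus // mulrC divfK // natr_ffact.
Qed.

Lemma riccati_locus0 (K : fieldType) (m : nat) (c : K) :
  riccati_locus m c 0 = 0.
Proof. by apply/rowP=> i; rewrite !mxE. Qed.

(** The first coordinate is [n / c]; characteristic zero keeps it nonzero. *)
Lemma riccati_locus_neq0 (K : numFieldType) (m : nat) (hm : (0 < m)%N) (c : K)
    (n : nat) :
  c != 0 -> (0 < n)%N -> riccati_locus m c n <> 0.
Proof.
move=> c0 n_gt0 /rowP /(_ (Ordinal hm)) /eqP; rewrite !mxE /= n_gt0 ffactn1.
by rewrite mulf_eq0 invr_eq0 (negbTE c0) orbF pnatr_eq0 -leqn0 leqNgt n_gt0.
Qed.

Theorem lemma3p1 (R : realType) (m : nat) (hm : (1 <= m)%N) (c : R[i])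
    (hc : c <> 0) :
  (forall n : nat, (1 <= n <= m)%N ->
     indicial_equations (@riccati_weight m) (riccatiA hm c)
       (riccati_locus m c n)) /\
  (forall xi : 'rV[R[i]]_m,
     indicial_locus (@riccati_weight m) (riccatiA hm c) xi <->
     exists2 n : nat, (1 <= n <= m)%N & xi = riccati_locus m c n).
Proof.
have c0 : c != 0 by apply/eqP.
split=> [n /andP[_ le_nm]|xi]; first exact: riccati_locus_indicial.
split=> [[xi0 eqs]|[n /andP[n_gt0 le_nm] ->]]; last first.
  by split; [exact: riccati_locus_neq0 | exact: riccati_locus_indicial].
have [[|n] le_nm xiE] := indicial_is_riccati_locus c0 eqs; last by exists n.+1.
by case: xi0; rewrite xiE riccati_locus0.
Qed.
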